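(* Let $\mathbb{F}_q$ be a finite field, let $n\ge 1$, and let $k\ge 0$ be an integer with $k<\lfloor n/2\rfloor$. Let $\omega_{2nk}=L^2(M_{n,k}(\mathbb{F}_q))$ be the representation of $GL_n(\mathbb{F}_q)\times GL_k(\mathbb{F}_q)$ described in the context, with decomposition $\omega_{2nk}\simeq\sum_{\nu\in\widehat{GL}_k}\Xi_\nu\otimes\nu$. Then: 1. The new $k$-spectrum and the $U$-rank $k$ spectrum of $\omega_{2nk}$ coincide, i.e. $(\omega_{2nk})^{new}_{GL_n}=(\omega_{2nk})^{U,k}_{GL_n}$ as subspaces of $\omega_{2nk}$. 2. The domain of the eta correspondence $\nu\mapsto\eta(\nu)$ is all of $\widehat{GL}_k$. In particular, for every $\nu\in\widehat{GL}_k$ there is a unique irreducible representation $\eta(\nu)$ of $GL_n$ of $U$-rank $k$ contained in $\Xi_\nu$; it appears in $\Xi_\nu$ with multiplicity one, and all other irreducible components of $\Xi_\nu$ have $U$-rank smaller than $k$.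
   Context: All representations are finite dimensional and complex; $\widehat G$ is the set of isomorphism classes of irreducible representations of a finite group $G$. $GL_n=GL_n(\mathbb{F}_q)$, and $GL_0$ is the trivial group. The representation $\omega_{2nk}$: it is the restriction to the dual pair $GL_n\times GL_k\subset Sp_{2nk}$ of the oscillator (Weil) representation, realized as the permutation representation on the space $L^2(M_{n,k})$ of complex functions on the $n\times k$ matrices over $\mathbb{F}_q$, with $GL_n$ acting by left multiplication of matrices and $GL_k$ by right multiplication. For $\nu\in\widehat{GL}_k$, $\Xi_\nu=\mathrm{Hom}_{GL_k}(\nu,\omega_{2nk})$, a representation of $GL_n$ (possibly zero). New spectrum: let $\widehat{GL}_n(\omega_{2nk})$ be the set of irreducible representations of $GL_n$ that appear in $\omega_{2nk}$. These sets increase with $k$. The new $k$-spectrum is $(\widehat{GL}_n)_{new,k}=\widehat{GL}_n(\omega_{2nk})\smallsetminus\widehat{GL}_n(\omega_{2n(k-1)})$ (for $k=0$ it consists of the trivial representation). $(\omega_{2nk})^{new}_{GL_n}\subset\omega_{2nk}$ is the sum of the $GL_n$-isotypic components of members of $(\widehat{GL}_n)_{new,k}$. Eta correspondence (known fact): on $(\omega_{2nk})^{new}_{GL_n}$ the algebras generated by $GL_n$ and by $GL_k$ are each other's commutant. Hence each $\Xi_\nu$ contains at most one member of $(\widehat{GL}_n)_{new,k}$, with multiplicity at most one; the domain of the eta correspondence is the set of $\nu$ for which $\Xi_\nu$ contains such a member, and $\eta(\nu)$ denotes that member. The map $\nu\mapsto\eta(\nu)$ is a bijection from its domain onto $(\widehat{GL}_n)_{new,k}$.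 $U$-rank: let $U\subset GL_n$ be the abelian group of matrices $\begin{bmatrix} I_a & T\\ 0& I_b\end{bmatrix}$, $T\in M_{a,b}(\mathbb{F}_q)$, with $a=b=n/2$ if $n$ is even and $a=(n-1)/2$, $b=(n+1)/2$ if $n$ is odd. Fix a nontrivial additive character $\chi_0$ of $\mathbb{F}_q$. Every character of $U$ has the form $T'\mapsto\chi_0(\mathrm{trace}(T^tT'))$ for a unique $T\in M_{a,b}$, and its rank is the rank of $T$. The $U$-rank of a representation $\pi$ of $GL_n$ is the maximum of the ranks of the characters of $U$ appearing in $\pi_{|U}$. $(\widehat{GL}_n)_{U,k}$ is the set of irreducible representations of $U$-rank $k$, and $(\omega_{2nk})^{U,k}_{GL_n}\subset\omega_{2nk}$ is the sum of the $GL_n$-isotypic components of members of $(\widehat{GL}_n)_{U,k}$. *)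

(* Defs.v *)
From HB Require Import structures.
From mathcomp Require Import all_boot all_order all_algebra all_fingroup.
From mathcomp Require Import mxrepresentation boolp.

Set Implicit Arguments.
Unset Strict Implicit.
Unset Printing Implicit Defensive.

Import GRing.Theory Num.Theory.
Local Open Scope ring_scope.

(* MathComp's {'GL_n[F]} is made of matrices of size n.-1.+1, hence is wrong
   for n = 0; this version is uniform in n, and GL F 0 is the trivial group. *)
Record GL (F : finFieldType) (n : nat) : Type :=
  MkGL { GLmx :> 'M[F]_n; GLmxP : GLmx \in unitmx }.

HB.instance Definition _ (F : finFieldType) (n : nat) :=
  [isSub for @GLmx F n].
HB.instance Definition _ (F : finFieldType) (n : nat) :=
  [Finite of GL F n by <:].

Section GLgroup.
Variables (F : finFieldType) (n : nat).
Implicit Types g h : GL F n.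

Fact GL_one_subproof : (1%:M : 'M[F]_n) \in unitmx.
Proof. exact: unitmx1. Qed.

Fact GL_mul_subproof g h : (g : 'M_n) *m h \in unitmx.
Proof. by rewrite unitmx_mul !GLmxP. Qed.

Fact GL_inv_subproof g : invmx g \in unitmx.
Proof. by rewrite unitmx_inv GLmxP. Qed.

Definition GL_one : GL F n := MkGL GL_one_subproof.
Definition GL_mul g h : GL F n := MkGL (GL_mul_subproof g h).
Definition GL_inv g : GL F n := MkGL (GL_inv_subproof g).

Fact GL_mulA : associative GL_mul.
Proof. by move=> g h l; apply: val_inj; rewrite /= mulmxA. Qed.

Fact GL_mul1 : left_id GL_one GL_mul.
Proof. by move=> g; apply: val_inj; rewrite /= mul1mx. Qed.

Fact GL_mulV : left_inverse GL_one GL_inv GL_mul.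
Proof. by move=> g; apply: val_inj; rewrite /= mulVmx ?GLmxP. Qed.

HB.instance Definition _ := Finite_isGroup.Build (GL F n)
  GL_mulA GL_mul1 GL_mulV.

Lemma GLmx1 : GLmx (1%g : GL F n) = 1%:M. Proof. by []. Qed.
Lemma GLmxM g h : GLmx (g * h)%g = GLmx g *m GLmx h. Proof. by []. Qed.
Lemma GLmxV g : GLmx g^-1%g = invmx (GLmx g). Proof. by []. Qed.

End GLgroup.

(* A member of \hat G is an irreducible matrix representation, two of them
   being identified when they are isomorphic (iso_irrep). *)
Record irrep (C : numClosedFieldType) (gT : finGroupType) (G : {group gT}) :=
  Irrep {
    irrep_deg : nat;
    irrep_repr :> mx_representation C G irrep_deg;
    irrep_irr : mx_irreducible irrep_repr
  }.

Section Representations.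
Variables (C : numClosedFieldType) (gT : finGroupType) (G : {group gT}).

Definition iso_irrep (pi sigma : irrep C G) : Prop := mx_rsim pi sigma.

Definition appears_in d (pi : irrep C G) (rho : mx_representation C G d) :
    Prop :=
  exists (U : 'M[C]_d) (modU : mxmodule rho U), mx_rsim pi (submod_repr modU).

(* The row space of hom_mx rho sigma consists of the mxvec A, for A in
   Hom_G(rho, sigma); homomorphisms act on row vectors (see hom_mxP). *)
Definition hom_mx d e (rho : mx_representation C G d)
    (sigma : mx_representation C G e) : 'M[C]_(d * e) :=
  (\bigcap_(g in G) kermx (lin_mulmx (rho g) - lin_mulmxr (sigma g)))%MS.

Lemma hom_mxP d e (rho : mx_representation C G d)
    (sigma : mx_representation C G e) (A : 'M[C]_(d, e)) :
  reflect {in G, forall g, rho g *m A = A *m sigma g}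
          (mxvec A <= hom_mx rho sigma)%MS.
Proof.
apply: (iffP sub_bigcapmxP) => homA g Gg.
  have /sub_kermxP := homA g Gg.
  rewrite mulmxBr !mul_vec_lin /= -raddfB /= => /eqP.
  by rewrite mxvec_eq0 subr_eq0 => /eqP.
apply/sub_kermxP; rewrite mulmxBr !mul_vec_lin /= -raddfB /= homA //.
by rewrite subrr linear0.
Qed.

(* G acts on all linear maps A : 'M[C]_(m, d) into rho by post-composition. *)
Fact postcomp_mx_repr m d (rho : mx_representation C G d) :
  mx_repr G (fun g => lin_mulmxr (rho g) : 'M[C]_(m * d)).
Proof.
have mx_inj p (f h : 'M[C]_p) : (forall v : 'rV_p, v *m f = v *m h) -> f = h.
  by move=> eq_fh; apply/row_matrixP=> i; rewrite !rowE.
split=> [|g g' Gg Gg']; apply: mx_inj => v; rewrite -(vec_mxK v).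
  by rewrite mul_vec_lin /= repr_mx1 !mulmx1.
by rewrite mulmxA !mul_vec_lin /= repr_mxM // mulmxA.
Qed.

Definition postcomp_repr m d (rho : mx_representation C G d) :
    mx_representation C G (m * d) :=
  MxRepresentation (postcomp_mx_repr m rho).

Definition multiplicity d (pi : irrep C G) (rho : mx_representation C G d) :
    nat :=
  \rank (hom_mx pi rho).

Definition irrep_of_socle d (rho : mx_representation C G d)
    (W : DecSocleType rho) : irrep C G :=
  Irrep (socle_irr W).

(* Subspaces are row spaces; W : DecSocleType rho ranges over the isotypic
   components of rho. *)
Definition isotypic_sum d (rho : mx_representation C G d)
    (S : irrep C G -> Prop) : 'M[C]_d :=
  (\sum_(W : DecSocleType rho | `[< S (irrep_of_socle W) >]) W)%MS.

End Representations.

Section Omega.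
Variables (C : numClosedFieldType) (F : finFieldType) (n k : nat).

(* The row vector v stands for the function X |-> v 0 (enum_rank X). On
   functions, (g, h) acts by (omega (g, h) f)(X) = f (g^-1 X h); this is the
   matrix of that operator, for functions written as column vectors. On row
   vectors it sends the delta function at X to the one at g^-1 X h (the
   associated right action, which has the same invariant subspaces). *)
Definition omega_mx (gh : GL F n * GL F k) : 'M[C]_#|{: 'M[F]_(n, k)}| :=
  \matrix_(i, j)
    (enum_val j == invmx gh.1 *m enum_val i *m (gh.2 : 'M_k))%:R.

Fact omega_mx_repr : mx_repr [set: GL F n * GL F k] omega_mx.
Proof.
split=> [|[g h] [g' h'] _ _].
  apply/matrixP=> i j; rewrite !mxE /= invmx1 mul1mx mulmx1.
  by rewrite (inj_eq enum_val_inj) eq_sym.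
apply/matrixP=> i j; rewrite !mxE /=.
rewrite (bigD1 (enum_rank (invmx g *m enum_val i *m h))) //= !mxE enum_rankK.
rewrite eqxx mul1r big1 ?addr0 => [|l /eqP ne_l].
  rewrite /= (_ : invmx _ = invmx g' *m invmx g) ?mulmxA //.
  exact: (congr1 (@GLmx F n) (invMg g g')).
rewrite !mxE /=; case: eqP => [def_l|_]; last by rewrite mul0r.
by case: ne_l; rewrite -def_l enum_valK.
Qed.

Definition omega : mx_representation C [set: GL F n * GL F k]
    #|{: 'M[F]_(n, k)}| := MxRepresentation omega_mx_repr.

Fact omegaL_repr :
  mx_repr [set: GL F n] (fun g => omega (g, 1%g)).
Proof.
split=> [|g g' _ _]; first by rewrite -(repr_mx1 omega).
by rewrite -repr_mxM ?in_setT //=; congr omega_mx; congr (_, _); rewrite mulg1.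
Qed.

Definition omegaL : mx_representation C [set: GL F n]
    #|{: 'M[F]_(n, k)}| := MxRepresentation omegaL_repr.

Fact omegaR_repr :
  mx_repr [set: GL F k] (fun h => omega (1%g, h)).
Proof.
split=> [|h h' _ _]; first by rewrite -(repr_mx1 omega).
by rewrite -repr_mxM ?in_setT //=; congr omega_mx; congr (_, _); rewrite mulg1.
Qed.

Definition omegaR : mx_representation C [set: GL F k]
    #|{: 'M[F]_(n, k)}| := MxRepresentation omegaR_repr.

Lemma omegaLR_comm g h : omegaL g *m omegaR h = omegaR h *m omegaL g.
Proof.
rewrite /= -!(@repr_mxM _ _ _ _ omega) ?in_setT //.
by congr omega_mx; congr (_, _); rewrite ?mulg1 ?mul1g.
Qed.

Section Xi.
Variable nu : irrep C [set: GL F k].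

Fact Xi_module :
  mxmodule (postcomp_repr (irrep_deg nu) omegaL) (hom_mx nu omegaR).
Proof.
apply/mxmoduleP=> g _; apply/row_subP=> i; rewrite row_mul.
have := row_sub i (hom_mx nu omegaR); move: (row i _) => v.
rewrite -(vec_mxK v); move: (vec_mx v) => A /hom_mxP homA.
rewrite mul_vec_lin; apply/hom_mxP=> h Gh.
by rewrite mulmxA homA // -!mulmxA omegaLR_comm.
Qed.

(* Xi_nu = Hom_{GL_k}(nu, omega), as a representation of GL_n *)
Definition Xi : mx_representation C [set: GL F n] (\rank (hom_mx nu omegaR)) :=
  submod_repr Xi_module.

End Xi.
End Omega.

Definition is_trivial_irrep (C : numClosedFieldType) (gT : finGroupType)
    (G : {group gT}) (pi : irrep C G) : Prop :=
  irrep_deg pi = 1%N /\ {in G, forall g, pi g = 1%:M}.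

Definition new_spectrum (C : numClosedFieldType) (F : finFieldType) (n k : nat)
    (pi : irrep C [set: GL F n]) : Prop :=
  if k is k'.+1 then
    appears_in pi (omegaL C F n k'.+1) /\ ~ appears_in pi (omegaL C F n k')
  else is_trivial_irrep pi.

(* eta is the functional relation "eta(nu) is defined and is equal to pi". *)
Definition eta (C : numClosedFieldType) (F : finFieldType) (n k : nat)
    (nu : irrep C [set: GL F k]) (pi : irrep C [set: GL F n]) : Prop :=
  new_spectrum k pi /\ appears_in pi (Xi n nu).

Definition eta_domain (C : numClosedFieldType) (F : finFieldType) (n k : nat)
    (nu : irrep C [set: GL F k]) : Prop :=
  exists pi : irrep C [set: GL F n], eta nu pi.

Definition nontrivial_additive_character (C : numClosedFieldType)
    (F : finFieldType) (chi : F -> C) : Prop :=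
  [/\ chi 0 = 1, {morph chi : x y / x + y >-> x * y} & exists x, chi x != 1].

Section URank.
Variables (C : numClosedFieldType) (F : finFieldType) (chi0 : F -> C) (n : nat).

Fact U_size : (n./2 + uphalf n = n)%N.
Proof. by rewrite uphalf_half addnCA addnn odd_double_half. Qed.

Definition U_mx (T : 'M[F]_(n./2, uphalf n)) : 'M[F]_n :=
  castmx (U_size, U_size) (block_mx 1%:M T 0 1%:M).

Fact U_mx_unit T : U_mx T \in unitmx.
Proof.
suff unit_cast m (e : (n./2 + uphalf n = m)%N) :
    castmx (e, e) (block_mx 1%:M T 0 1%:M) \in unitmx by exact: unit_cast.
case: m / e; rewrite castmx_id.
by rewrite unitmxE det_ublock !det1 mulr1 unitr1.
Qed.

Definition U_elt T : GL F n := MkGL (U_mx_unit T).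

Definition U_char (T T' : 'M[F]_(n./2, uphalf n)) : C :=
  chi0 (\tr (T^T *m T')).

(* The character U_char T of U appears in the restriction of pi to U. *)
Definition U_char_appears (pi : irrep C [set: GL F n])
    (T : 'M[F]_(n./2, uphalf n)) : Prop :=
  exists2 v : 'rV[C]_(irrep_deg pi),
    v != 0 & forall T', v *m pi (U_elt T') = U_char T T' *: v.

Definition U_rank (pi : irrep C [set: GL F n]) : nat :=
  \max_(T : 'M[F]_(n./2, uphalf n) | `[< U_char_appears pi T >]) \rank T.

End URank.

(* Main.v *)
Require Import Defs.
From mathcomp Require Import all_boot all_order all_algebra all_fingroup.
From mathcomp Require Import mxrepresentation boolp.

(* U acts on functions on M_{n,k} through the top block of rows: a character T
   of U occurs in omega_{2nk} only if rank T <= k, and when rank T = k the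
   T-weight space is the regular representation of GL_k. A copy of GL_k in the
   stabiliser of T in the Levi subgroup acts on it by the other translations, so
   the T-weight space of Xi_nu is the irreducible dual of nu; hence exactly one
   constituent of Xi_nu, with multiplicity one, has U-rank k.

   It remains to see that a constituent pi of omega_{2nk} of U-rank < k occurs
   in omega_{2n(k-1)}. A GL_n-invariant kernel K(X, Y) depends only on the row
   space of [X Y], so it is a combination of the indicators of row space [X Y]
   <= W, for subspaces W of F^{2k}. These kernels factor through
   omega_{2n(k-1)}, unless W is the graph of some h in GL_k. Thus the projection
   e onto pi is, modulo operators factoring through omega_{2n(k-1)}, an element
   of the group algebra of GL_k. If T has rank k, both e and these operators
   vanish on the T-weight space, on which the group algebra acts faithfully; so
   e itself factors. *)

Set Implicit Arguments.
Unset Strict Implicit.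
Unset Printing Implicit Defensive.

Import GRing.Theory Num.Theory.
Local Open Scope ring_scope.

(** * Intertwiners, averaging and weight vectors *)

Section RepresentationTheory.
Variables (C : numClosedFieldType) (gT : finGroupType) (G : {group gT}).

Definition intertwines d e (rho : mx_representation C G d)
    (sigma : mx_representation C G e) (A : 'M[C]_(d, e)) :=
  {in G, forall g, rho g *m A = A *m sigma g}.

Lemma intertwinesM d e f (rho : mx_representation C G d)
    (sigma : mx_representation C G e) (tau : mx_representation C G f) A B :
  intertwines rho sigma A -> intertwines sigma tau B ->
  intertwines rho tau (A *m B).
Proof.
by move=> hA hB g Gg; rewrite mulmxA hA // -!mulmxA hB.
Qed.

Lemma intertwines_row_free d (pi : irrep C G) (rho : mx_representation C G d)
    (A : 'M_(irrep_deg pi, d)) :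
  intertwines pi rho A -> A != 0 -> row_free A.
Proof.
move=> hA; rewrite -kermx_eq0; apply: contraNT => nz_ker.
have [_ irr_pi] := (mx_irrP pi).1 (irrep_irr pi).
have modK : mxmodule pi (kermx A).
  by apply/mxmoduleP=> g Gg; apply/sub_kermxP; rewrite -mulmxA hA // mulmxA
     mulmx_ker mul0mx.
have := irr_pi _ modK nz_ker; rewrite -sub1mx => /sub_kermxP.
by rewrite mul1mx => ->.
Qed.

(** A nonzero homomorphism out of an irreducible representation is injective, so its image is a copy
    of [pi]. This replaces submodules by matrices that can be composed. *)
Lemma appears_inP d (pi : irrep C G) (rho : mx_representation C G d) :
  appears_in pi rho <->
    exists2 A : 'M_(irrep_deg pi, d), A != 0 & intertwines pi rho A.
Proof.
split=> [[U [modU [B def_d freeB hB]]] | [A nzA hA]].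
  exists (val_submod B).
    rewrite val_submod_eq0 -mxrank_eq0 (eqnP freeB) -lt0n.
    by have [] := (mx_irrP pi).1 (irrep_irr pi).
  by move=> g Gg; rewrite -val_submodJ // -hB // /val_submod /= mulmxA.
have freeA := intertwines_row_free hA nzA.
have modA : mxmodule rho <<A>>%MS.
  rewrite (eqmx_module _ (genmxE A)); apply/mxmoduleP=> g Gg.
  by rewrite -hA // submxMl.
have sA : (A <= <<A>>)%MS by rewrite genmxE.
exists <<A>>%MS, modA; exists (in_submod <<A>>%MS A).
- by rewrite genmxE (eqnP freeA).
- by rewrite /row_free mxrank_in_submod // (eqnP freeA).
move=> g Gg; rewrite -in_submodJ // -hA //.
by rewrite [RHS]in_submodE -mulmxA -in_submodE.
Qed.

Lemma natr_cardG_neq0 : #|G|%:R != 0 :> C.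
Proof. by rewrite pnatr_eq0 -lt0n cardG_gt0. Qed.

(** Maschke's averaging: a linear right inverse [R] of [A] becomes equivariant when averaged over
    [G]. *)
Lemma intertwines_retraction d e (rho : mx_representation C G d)
    (sigma : mx_representation C G e) (A : 'M_(d, e)) :
  intertwines rho sigma A -> row_free A ->
  exists2 B, intertwines sigma rho B & A *m B = 1%:M.
Proof.
move=> hA /row_freeP[R AR].
exists (#|G|%:R^-1 *: \sum_(x in G) sigma x^-1%g *m R *m rho x).
  move=> g Gg; rewrite -scalemxAl -scalemxAr; congr (_ *: _).
  rewrite [in LHS](reindex_acts 'R _ Gg) ?astabsR //= mulmx_suml mulmx_sumr.
  apply: eq_bigr => y Gy; rewrite !mulmxA -repr_mxM ?groupV ?groupM //.
  by rewrite invMg mulKVg repr_mxM // !mulmxA.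
rewrite -scalemxAr mulmx_sumr (eq_bigr (fun _ => 1%:M)) => [|x Gx].
  by rewrite sumr_const -scaler_nat scalerA mulVf ?natr_cardG_neq0 ?scale1r.
by rewrite !mulmxA -hA ?groupV // -(mulmxA _ A) AR mulmx1
   -repr_mxM ?groupV // mulVg repr_mx1.
Qed.

Lemma irrep_abs_irr (pi : irrep C G) : mx_absolutely_irreducible pi.
Proof. exact: group_closure_closed_field (irrep_irr pi). Qed.

Lemma completely_reducible d (rho : mx_representation C G d) :
  mx_completely_reducible rho 1%:M.
Proof.
apply: mx_Maschke_pchar; suff: [pchar C]^'.-nat #|G| by [].
by rewrite pcharf'_nat natr_cardG_neq0.
Qed.

Lemma intertwines_iso (pi sigma : irrep C G)
    (A : 'M_(irrep_deg pi, irrep_deg sigma)) :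
  intertwines pi sigma A -> A != 0 -> iso_irrep pi sigma.
Proof.
move=> hA nzA; have freeA := intertwines_row_free hA nzA.
have modA : mxmodule sigma <<A>>%MS.
  rewrite (eqmx_module _ (genmxE A)); apply/mxmoduleP=> g Gg.
  by rewrite -hA // submxMl.
have [_ irr_s] := (mx_irrP sigma).1 (irrep_irr sigma).
have fullA : row_full A.
  by rewrite -sub1mx -(genmxE A) sub1mx irr_s // (eqmx_eq0 (genmxE A)).
by exists A => //; rewrite -(eqnP freeA) (eqP fullA).
Qed.

Section Weights.
Variables (I : Type) (u : I -> gT) (c : I -> C).
Hypothesis Gu : forall i, u i \in G.

(** Meant for [u] the parametrization of a unipotent subgroup by matrices and [c] one of its
    characters. *)
Definition weight_vector d (rho : mx_representation C G d) (v : 'rV_d) :=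
  forall i, v *m rho (u i) = c i *: v.

Lemma weight_vector_intertwines d e (rho : mx_representation C G d)
    (sigma : mx_representation C G e) A v :
  intertwines rho sigma A -> weight_vector rho v -> weight_vector sigma (v *m A).
Proof. by move=> hA wv i; rewrite -mulmxA -hA // mulmxA wv scalemxAl. Qed.

(** A nonzero submodule [U] has an invariant complement [W], and the projection of [w0] to [U] is
    again a weight vector. If it vanishes, [w0] lies in [W], and then so does [U], which is absurd;
    otherwise it generates [w0] by hypothesis. *)
Lemma cyclic_weight_simple d (rho : mx_representation C G d) w0 :
  w0 != 0 -> weight_vector rho w0 ->
  (forall w w', weight_vector rho w -> w != 0 -> weight_vector rho w' ->
     (w' <= cyclic_mx rho w)%MS) ->
  mxsimple rho (cyclic_mx rho w0).
Proof.
move=> nz0 wt0 cyc; split; rewrite ?cyclic_mx_module ?cyclic_mx_eq0 //.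
move=> U modU sU nzU.
have [W modW defV dxUW] := completely_reducible modU (submx1 U).
have dx0 : (U :&: W = 0)%MS := mxdirect_addsP dxUW.
have s1 : (w0 <= U + W)%MS by rewrite defV submx1.
have hom_p : intertwines rho rho (proj_mx U W).
  have: centgmx rho (proj_mx U W).
    by rewrite -row_full_dom_hom -sub1mx -defV proj_mx_hom.
  by move/centgmxP=> cf g Gg; rewrite cf.
have [z|nz] := eqVneq (w0 *m proj_mx U W) 0.
  have sW : (w0 <= W)%MS.
    by rewrite -(add_proj_mx dx0 s1) z add0r proj_mx_sub.
  have sUW : (U <= W)%MS.
    by apply: submx_trans sU _; rewrite cyclic_mx_sub.
  by case/negP: nzU; rewrite -submx0 -dx0 sub_capmx submx_refl.
apply: submx_trans (cyclic_mx_sub modU (proj_mx_sub U W w0)).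
rewrite cyclic_mx_sub ?cyclic_mx_module // cyc //.
exact: (weight_vector_intertwines hom_p).
Qed.

(** All nonzero weight vectors generate the same simple module [V]. A copy in [rho] of an
    irreducible representation with a weight vector contains a weight vector of [rho], hence
    contains [V]. *)
Lemma cyclic_weight_irrep d (rho : mx_representation C G d) w0 :
  w0 != 0 -> weight_vector rho w0 ->
  (forall w w', weight_vector rho w -> w != 0 -> weight_vector rho w' ->
     (w' <= cyclic_mx rho w)%MS) ->
  exists eta : irrep C G,
    [/\ appears_in eta rho,
        exists2 v, v != 0 & weight_vector eta v,
        forall pi : irrep C G, appears_in pi rho ->
          (exists2 v, v != 0 & weight_vector pi v) -> iso_irrep pi eta
      & multiplicity eta rho = 1%N].
Proof.
move=> nz0 wt0 cyc; have simV := cyclic_weight_simple nz0 wt0 cyc.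
set V := cyclic_mx rho w0 in simV; have modV := mxsimple_module simV.
have w0V : (w0 <= V)%MS := cyclic_mx_id rho w0.
pose eta := Irrep ((submod_mx_irr modV).2 simV).
pose v0 : 'rV_(irrep_deg eta) := in_submod V w0.
have nzv0 : v0 != 0 by rewrite -val_submod_eq0 in_submodK.
have wt_v0 : weight_vector eta v0.
  by move=> i; rewrite /= -in_submodJ // wt0 linearZ.
have sV (pi : irrep C G) A v : intertwines pi rho A -> A != 0 -> v != 0 ->
    weight_vector pi v -> (V <= A)%MS.
  move=> hA nzA nzv wtv.
  have modA : mxmodule rho A by apply/mxmoduleP=> g Gg; rewrite -hA // submxMl.
  have freeA := intertwines_row_free hA nzA.
  have nzvA : v *m A != 0 by rewrite mulmx_free_eq0.
  rewrite cyclic_mx_sub // (submx_trans (cyc _ _ _ nzvA wt0)) //.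
    exact: weight_vector_intertwines wtv.
  by rewrite cyclic_mx_sub // submxMl.
have hom1 : intertwines eta rho (val_submod (1%:M : 'M_(\rank V))).
  by move=> g Gg; rewrite -val_submodJ // mul1mx /val_submod /= mul1mx.
have nz1 : val_submod (1%:M : 'M_(\rank V)) != 0.
  by rewrite -mxrank_eq0 val_submod1 mxrank_eq0 cyclic_mx_eq0.
exists eta; split.
- by exists V, modV; apply: mx_rsim_refl.
- by exists v0.
- move=> pi /appears_inP[A nzA hA] [v nzv wtv].
  have freeA := intertwines_row_free hA nzA.
  (* The image of [A] contains [V], so the inclusion of [V] is [D *m A]; injectivity of [A] makes
     [D] equivariant. *)
  have := sV _ _ _ hA nzA nzv wtv; rewrite -val_submod1 => /submxP[D defD].
  apply: mx_rsim_sym; apply: (@intertwines_iso eta pi D) => [g Gg|].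
    apply: (row_free_inj freeA); rewrite -[RHS]mulmxA hA // [RHS]mulmxA -defD.
    by rewrite -hom1 // [in RHS]defD mulmxA.
  by apply: contraNneq nz1 => D0; rewrite defD D0 mul0mx.
rewrite /multiplicity.
(* A nonzero homomorphism has image [V] by comparison of ranks, so Schur's lemma makes it a multiple
   of the inclusion. *)
suff ->: (hom_mx eta rho :=: mxvec (val_submod (1%:M : 'M_(\rank V))))%MS.
  by rewrite rank_rV mxvec_eq0 nz1.
apply/eqmxP/andP; split; last by apply/Defs.hom_mxP.
apply/row_subP=> i; have := row_sub i (hom_mx eta rho); move: (row i _) => v.
rewrite -(vec_mxK v); move: (vec_mx v) => {v} A /Defs.hom_mxP homA.
have [->|nzA] := eqVneq A 0; first by rewrite linear0 sub0mx.
have sVA := sV _ _ _ homA nzA nzv0 wt_v0.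
have sAV : (A <= V)%MS.
  by rewrite -(geq_leqif (mxrank_leqif_sup sVA)) rank_leq_row.
have /is_scalar_mxP[a defa] : is_scalar_mx (in_submod V A).
  apply: (mx_abs_irr_cent_scalar (irrep_abs_irr eta)); apply/centgmxP=> g Gg.
  rewrite /= -in_submodJ // -homA // [LHS]in_submodE [in RHS]in_submodE.
  by rewrite [in RHS]mulmxA.
rewrite -(in_submodK sAV) defa -scalemx1 !linearZ /=.
exact: scalemx_sub.
Qed.

End Weights.
End RepresentationTheory.

(** * Matrices of kernels on finite sets *)

Section FunctionMatrices.
Variables (C : numClosedFieldType).

Definition fun_mx (S T : finType) (f : S -> T -> C) : 'M[C]_(#|S|, #|T|) :=
  \matrix_(i, j) f (enum_val i) (enum_val j).

Lemma fun_mxE (S T : finType) (f : S -> T -> C) x y :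
  fun_mx f (enum_rank x) (enum_rank y) = f x y.
Proof. by rewrite mxE !enum_rankK. Qed.

Lemma matrix_rankP (T : finType) r (A B : 'M[C]_(r, #|T|)) :
  (forall i x, A i (enum_rank x) = B i (enum_rank x)) -> A = B.
Proof. by move=> eqAB; apply/matrixP=> i j; rewrite -(enum_valK j). Qed.

Lemma mul_fun_mxE (S T : finType) r (A : 'M_(r, #|S|)) (f : S -> T -> C) i y :
  (A *m fun_mx f) i (enum_rank y) = \sum_x A i (enum_rank x) * f x y.
Proof.
rewrite mxE (reindex (@enum_rank S)); last exact/onW_bij/enum_rank_bij.
by apply: eq_bigr => x _; rewrite fun_mxE.
Qed.

End FunctionMatrices.

(** Partial identities pad the full-rank factorization to inner size exactly [r]. *)
Lemma rank_factor (K : fieldType) m p r (P : 'M[K]_(m, p)) :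
  (\rank P <= r)%N -> exists P1 : 'M_(m, r), exists P2 : 'M_(r, p), P = P1 *m P2.
Proof.
move=> le_r; exists (col_base P *m pid_mx (\rank P)).
exists (pid_mx (\rank P) *m row_base P).
by rewrite mulmxA -(mulmxA (col_base P)) pid_mx_id // pid_mx_1 mulmx1 mulmx_base.
Qed.

(** * Operators between the oscillator representations *)

Section OmegaOperators.
Variables (C : numClosedFieldType) (F : finFieldType) (n : nat).

Lemma mul_omegaE m r (A : 'M[C]_(r, #|{: 'M[F]_(n, m)}|)) g h i Y :
  (A *m omega C F n m (g, h)) i (enum_rank Y)
    = A i (enum_rank (GLmx g *m Y *m invmx h)).
Proof.
rewrite (mul_fun_mxE A (fun X Y => (Y == invmx g *m X *m (h : 'M_m))%:R)).
have gU := GLmxP g; have hU := GLmxP h.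
rewrite (bigD1 (GLmx g *m Y *m invmx h)) //= big1 ?addr0 => [|X /eqP neX].
  by rewrite !mulmxA mulVmx // mul1mx mulmxKV // eqxx mulr1.
case: eqP => [defY|_]; last by rewrite mulr0.
by case: neX; rewrite defY !mulmxA mulmxV // mul1mx mulmxK.
Qed.

Lemma mul_omegaLE m r (A : 'M[C]_(r, #|{: 'M[F]_(n, m)}|)) g i Y :
  (A *m omegaL C F n m g) i (enum_rank Y) = A i (enum_rank (GLmx g *m Y)).
Proof. by rewrite mul_omegaE GLmx1 invmx1 mulmx1. Qed.

Lemma mul_omegaRE m r (A : 'M[C]_(r, #|{: 'M[F]_(n, m)}|)) h i Y :
  (A *m omegaR C F n m h) i (enum_rank Y) = A i (enum_rank (Y *m invmx h)).
Proof. by rewrite mul_omegaE GLmx1 mul1mx. Qed.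

Lemma omegaLE m g X Y :
  omegaL C F n m g (enum_rank X) (enum_rank Y) = (GLmx g *m Y == X)%:R.
Proof.
rewrite -[omegaL _ _ _ _ _]mul1mx mul_omegaLE mxE eq_sym.
by rewrite (inj_eq enum_rank_inj).
Qed.

(* Push-forward of delta functions along X |-> X P; the transpose is the
   pull-back of functions. *)
Definition push m1 m2 (P : 'M[F]_(m1, m2)) :=
  fun_mx (fun (X : 'M[F]_(n, m1)) (Y : 'M[F]_(n, m2)) => (Y == X *m P)%:R : C).

Lemma mul_push_trE m1 m2 (P : 'M_(m1, m2)) r (A : 'M_(r, _)) i Y :
  (A *m (push P)^T) i (enum_rank Y) = A i (enum_rank (Y *m P)).
Proof.
have -> : (push P)^T = fun_mx (fun X Y => (X == Y *m P)%:R : C).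
  by apply/matrixP=> ? ?; rewrite !mxE.
rewrite mul_fun_mxE (bigD1 (Y *m P)) //= eqxx mulr1 big1 ?addr0 // => X.
by move/negPf->; rewrite mulr0.
Qed.

Lemma push_mul m1 m2 m3 (P : 'M_(m1, m2)) (Q : 'M_(m2, m3)) :
  push (P *m Q) = push P *m push Q.
Proof.
apply: matrix_rankP => i Y; rewrite mul_fun_mxE -(enum_valK i) fun_mxE.
rewrite (bigD1 (enum_val i *m P)) //= fun_mxE eqxx mul1r mulmxA big1 ?addr0 // => X.
by move/negPf=> neX; rewrite fun_mxE neX mul0r.
Qed.

Lemma push_GL m (h : GL F m) : push (GLmx h) = omegaR C F n m h.
Proof.
by apply/matrixP=> i j; rewrite !mxE /= invmx1 mul1mx.
Qed.

Lemma push_intertwines m1 m2 (P : 'M_(m1, m2)) :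
  intertwines (omegaL C F n m1) (omegaL C F n m2) (push P).
Proof.
move=> g _; apply: matrix_rankP => i Y; have gU := GLmxP g.
rewrite mul_omegaLE mul_fun_mxE -(enum_valK i) fun_mxE.
rewrite (bigD1 (invmx g *m enum_val i)) //= omegaLE mulKVmx // eqxx mul1r big1.
  rewrite addr0; congr (nat_of_bool _)%:R; apply/eqP/eqP=> [->|].
    by rewrite !mulmxA mulmxV // mul1mx.
  by rewrite -mulmxA => <-; rewrite mulKmx.
move=> X neX; rewrite omegaLE; case: eqP => [defX|_]; last by rewrite mul0r.
by case/eqP: neX; rewrite -defX mulKmx.
Qed.

Lemma push_tr_intertwines m1 m2 (P : 'M_(m1, m2)) :
  intertwines (omegaL C F n m2) (omegaL C F n m1) (push P)^T.
Proof.
move=> g _; apply: matrix_rankP => i Y.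
rewrite mul_omegaLE mul_push_trE -(enum_valK i) omegaLE mxE fun_mxE.
by rewrite mulmxA eq_sym.
Qed.

(** * Invariant kernels modulo operators through the smaller oscillator representation *)

Section LowRank.
Variable k' : nat.
Local Notation k := k'.+1.

(** Both families of operators land in functions on n by [k'] matrices. They suffice because a
    matrix of rank less than [k] factors through size [k']. *)
Definition low_killed r (A : 'M[C]_(r, #|{: 'M[F]_(n, k)}|)) :=
  (forall P : 'M_(k, k'), A *m push P = 0) /\
  (forall Q : 'M_(k', k), A *m (push Q)^T = 0).

Lemma low_killed_push r (A : 'M_(r, _)) m (P : 'M_(k, m)) :
  low_killed A -> (\rank P < k)%N -> A *m push P = 0.
Proof.
case=> kA _; rewrite ltnS => /rank_factor[P1 [P2 ->]].
by rewrite push_mul mulmxA kA mul0mx.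
Qed.

Lemma low_killed_push_tr r (A : 'M_(r, _)) m (Q : 'M_(m, k)) :
  low_killed A -> (\rank Q < k)%N -> A *m (push Q)^T = 0.
Proof.
case=> _ kA; rewrite ltnS => /rank_factor[P1 [P2 ->]].
by rewrite push_mul trmx_mul mulmxA kA mul0mx.
Qed.

(** Joining the two arguments into one matrix turns equivariance of the kernel into invariance of
    [phi] under left multiplication, so that only the row space matters. *)
Definition kernel_mx (phi : 'M[F]_(n, k + k) -> C) :=
  fun_mx (fun X Y : 'M_(n, k) => phi (row_mx X Y)).

(* Modulo operators factoring through omega_{2n(k-1)}, the kernel phi acts
   through the group algebra of GL_k. *)
Definition acts_by_GL (phi : 'M[F]_(n, k + k) -> C) :=
  exists a : GL F k -> C, forall r (A : 'M_(r, _)), low_killed A ->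
    A *m kernel_mx phi = \sum_h a h *: (A *m omegaR C F n k h).

Lemma killed_acts_by_GL phi :
  (forall r (A : 'M_(r, _)), low_killed A -> A *m kernel_mx phi = 0) ->
  acts_by_GL phi.
Proof.
move=> kphi; exists (fun=> 0) => r A /kphi->.
by rewrite big1 // => h _; rewrite scale0r.
Qed.

Lemma acts_by_GL_push E phi : kernel_mx phi = push (E : 'M_k) -> acts_by_GL phi.
Proof.
move=> def_phi; have [ltE|geE] := ltnP (\rank E) k.
  by apply: killed_acts_by_GL => r A kA; rewrite def_phi low_killed_push.
have uE : E \in unitmx by rewrite -row_full_unit /row_full eqn_leq rank_leq_col.
exists (fun h => (h == MkGL uE)%:R) => r A _.
rewrite (bigD1 (MkGL uE)) // eqxx scale1r big1 => [|h /negPf->].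
  by rewrite [RHS]addr0 def_phi -push_GL.
by rewrite scale0r.
Qed.

(* If rank A > k, the condition is expressed by fewer than k linear equations;
   otherwise row_mx X Y = Z *m B for a unique Z, where B is a basis of A. *)
Lemma acts_by_GL_sub (A : 'M[F]_(n, k + k)) :
  acts_by_GL (fun M => (M <= A)%MS%:R).
Proof.
have [ltA|geA] := ltnP k (\rank A).
  pose P := usubmx (cokermx A); pose Q := dsubmx (cokermx A).
  have ltP : (\rank P < k)%N.
    apply: leq_ltn_trans (_ : \rank (cokermx A) < k)%N.
      by rewrite -[cokermx A in X in (_ <= X)%N]vsubmxK mxrankS // -addsmxE addsmxSl.
    by rewrite mxrank_coker -(ltn_add2r (\rank A)) subnK ?rank_leq_col // ltn_add2l.
  apply: killed_acts_by_GL => r B kB.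
  (* The linear equations read [X *m P = Y *m (- Q)]: push forward along [P], then pull back along
     [- Q]. *)
  suff ->: kernel_mx (fun M => (M <= A)%MS%:R) = push P *m (push (- Q))^T.
    by rewrite mulmxA low_killed_push ?mul0mx.
  apply: matrix_rankP => i Y; rewrite mul_push_trE -(enum_valK i) !fun_mxE.
  rewrite submxE -[cokermx A]vsubmxK mul_row_col mulmxN eq_sym.
  by rewrite [in RHS]eq_sym -[in RHS]addr_eq0 eq_sym.
have [B defB] : exists B : 'M_(\rank A, k + k), (B :=: A)%MS /\ row_free B.
  by exists (row_base A); split; [apply: eq_row_base | apply: row_base_free].
case: defB => defB freeB.
pose P := lsubmx B; pose Q := rsubmx B.
have subE X Y : (row_mx X Y <= A)%MS =
    [exists Z : 'M_(n, \rank A), (X == Z *m P) && (Y == Z *m Q)].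
  rewrite -defB; apply/submxP/existsP => [[Z]|[Z /andP[/eqP-> /eqP->]]].
    rewrite -[B]hsubmxK mul_mx_row => /eq_row_mx[-> ->].
    by exists Z; rewrite !eqxx.
  by exists Z; rewrite -mul_mx_row hsubmxK.
have [ltP|geP] := ltnP (\rank P) k.
  apply: killed_acts_by_GL => r D kD.
  suff ->: kernel_mx (fun M => (M <= A)%MS%:R) = (push P)^T *m push Q.
    by rewrite mulmxA low_killed_push_tr ?mul0mx.
  apply: matrix_rankP => i Y; rewrite mul_fun_mxE -(enum_valK i) fun_mxE.
  move: (enum_val i) => {i} X; rewrite subE.
  case: existsP => [[Z /andP[/eqP defX /eqP defY]]|noZ].
    rewrite (bigD1 Z) //= mxE fun_mxE defX defY !eqxx mulr1 big1 ?addr0 // => Z' neZ.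
    rewrite mxE fun_mxE; case: eqP => [eqX|_]; last by rewrite mul0r.
    case: eqP => [eqY|_]; last by rewrite mulr0.
    case/eqP: neZ; apply: (row_free_inj freeB).
    by rewrite -[B]hsubmxK !mul_mx_row -/P -/Q eqX eqY.
  rewrite big1 // => Z _; rewrite mxE fun_mxE -natrM mulnb.
  by case: andP => // [[/eqP e1 /eqP e2]]; case: noZ; exists Z; rewrite e1 e2 !eqxx.
have defk : \rank A = k.
  by apply/eqP; rewrite eqn_leq geA (leq_trans geP) // rank_leq_row.
move: B P Q defB freeB subE geP; rewrite defk => B P Q defB freeB subE geP.
have uP : P \in unitmx by rewrite -row_full_unit /row_full eqn_leq rank_leq_col.
(* The row space of [B] is the graph of [invmx P *m Q], which may still be singular. *)
apply: (@acts_by_GL_push (invmx P *m Q)).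
apply: matrix_rankP => i Y; rewrite -(enum_valK i) !fun_mxE subE mulmxA.
congr (nat_of_bool _)%:R; apply/existsP/eqP => [[Z /andP[/eqP-> /eqP->]]|->].
  by rewrite mulmxK.
by exists (enum_val i *m invmx P); rewrite mulmxKV // !eqxx.
Qed.

Lemma acts_by_GL_lincomb (I : finType) (R : pred I) (c : I -> C) phi psi :
  acts_by_GL psi -> (forall i, acts_by_GL (phi i)) ->
  acts_by_GL (fun M => psi M + \sum_(i | R i) c i * phi i M).
Proof.
case=> b hb /choice[a ha].
exists (fun h => b h + \sum_(i | R i) c i * a i h) => r A kA.
have -> : kernel_mx (fun M => psi M + \sum_(i | R i) c i * phi i M) =
    kernel_mx psi + \sum_(i | R i) c i *: kernel_mx (phi i).
  apply/matrixP=> x y; rewrite !mxE summxE; congr (_ + _).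
  by apply: eq_bigr => i _; rewrite !mxE.
rewrite mulmxDr hb // mulmx_sumr.
rewrite (eq_bigr (fun i => \sum_h (c i * a i h) *: (A *m omegaR C F n k h))); last first.
  move=> i _; rewrite -scalemxAr ha // scaler_sumr.
  by apply: eq_bigr => h _; rewrite scalerA.
rewrite exchange_big -big_split; apply: eq_bigr => h _ /=.
by rewrite scalerDl scaler_suml.
Qed.

(** Inversion over row spaces, by induction on a strict bound for the ranks in the support of [phi]:
    subtracting multiples of the indicators of [M <= A] with [A] of the top rank [r] cancels [phi]
    in rank [r] and changes it only in smaller ranks. *)
Lemma invariant_acts_by_GL (phi : 'M[F]_(n, k + k) -> C) :
  (forall g M, g \in unitmx -> phi (g *m M) = phi M) -> acts_by_GL phi.
Proof.
have [r] : exists r, forall M : 'M[F]_(n, k + k), (r <= \rank M)%N -> phi M = 0.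
  by exists n.+1 => M; rewrite ltnNge rank_leq_row.
elim: r phi => [|r IHr] phi supp inv_phi.
  apply: killed_acts_by_GL => r A _.
  have -> : kernel_mx phi = 0 by apply/matrixP=> i j; rewrite !mxE supp.
  by rewrite mulmx0.
(* The sum below runs over matrices rather than row spaces; dividing by [N] counts each row space
   once. *)
pose N (A : 'M[F]_(n, k + k)) :=
  #|[pred B : 'M[F]_(n, k + k) | (B == A)%MS]|%:R : C.
pose c A := phi A / N A.
pose psi M := phi M - \sum_(A | \rank A == r) c A * (M <= A)%MS%:R.
have -> : phi = fun M => psi M + \sum_(A | \rank A == r) c A * (M <= A)%MS%:R.
  by apply/funext=> M; rewrite subrK.
apply: acts_by_GL_lincomb => [|A]; last exact: acts_by_GL_sub.
apply: IHr => [M le_r|g M gU]; last first.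
  rewrite /psi inv_phi //; congr (_ - _); apply: eq_bigr => A _.
  by rewrite (eqmxMfull _ _) ?row_full_unit.
have eqphi A : (A == M)%MS -> c A = phi M / N M.
  case/eqmxMunitP=> g gU ->; rewrite /c inv_phi //.
  congr (_ / _%:R); apply: eq_card => B; rewrite !inE.
  by rewrite !(eqmxMfull _ _) ?row_full_unit.
rewrite /psi; have [lt_r|ge_r] := ltnP r (\rank M).
  rewrite supp // sub0r big1 ?oppr0 // => A /eqP rA.
  case: (boolP (M <= A)%MS) => [/mxrankS|]; last by rewrite mulr0.
  by rewrite rA leqNgt lt_r.
have rM : \rank M = r by apply/eqP; rewrite eqn_leq ge_r.
(* In rank [r], containment in the row space of [A] forces equality. *)
suff ->: \sum_(A | \rank A == r) c A * (M <= A)%MS%:R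
    = \sum_(A : 'M[F]_(n, k + k) | (A == M)%MS) phi M / N M.
  rewrite sumr_const -mulr_natr -/(N M) divfK ?subrr //.
  by rewrite pnatr_eq0 -lt0n; apply/card_gt0P; exists M; rewrite inE submx_refl.
rewrite big_mkcond [RHS]big_mkcond; apply: eq_bigr => A _.
have [eqA|neA] := boolP (A == M)%MS.
  rewrite (eqmx_rank eqA) rM eqxx eqphi //.
  by case/andP: eqA => _ ->; rewrite mulr1.
case: eqP => // rA; case: (boolP (M <= A)%MS) => [sMA|]; last by rewrite mulr0.
case/negP: neA; rewrite sMA andbT.
by rewrite -(geq_leqif (mxrank_leqif_sup sMA)) rA rM.
Qed.

End LowRank.
End OmegaOperators.

(** * Nondegeneracy of the trace pairing *)

Section AdditiveCharacter.
Variables (C : numClosedFieldType) (F : finFieldType) (chi0 : F -> C).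
Hypothesis chi0P : nontrivial_additive_character chi0.

(** At a nonzero entry [M i j], a multiple of [delta_mx j i] gives the trace the value [x], where
    [chi0] is not 1. *)
Lemma add_char_tr_nondegenerate m p (M : 'M[F]_(m, p)) :
  (forall S, chi0 (\tr (M *m S)) = 1) -> M = 0.
Proof.
have [_ _ [x chix]] := chi0P => triv; apply/matrixP=> i j; rewrite mxE.
apply: contraNeq chix => nzM; apply/eqP.
rewrite -[RHS](triv ((x / M i j) *: delta_mx j i)).
congr chi0; rewrite -scalemxAr linearZ /= [X in _ * X](_ : _ = M i j) ?divfK //.
rewrite /mxtrace (bigD1 i) //= big1 ?addr0 => [|l nel].
  rewrite mxE (bigD1 j) //= !mxE !eqxx mulr1 big1 ?addr0 // => l nel.
  by rewrite !mxE (negPf nel) mulr0.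
by rewrite mxE big1 // => l' _; rewrite !mxE (negPf nel) andbF mulr0.
Qed.

End AdditiveCharacter.

Lemma invmx_GLM (F : finFieldType) k (h h' : GL F k) :
  invmx (GLmx (h * h')%g) = invmx (GLmx h') *m invmx (GLmx h).
Proof. by rewrite -GLmxV invMg. Qed.

(** * Embedding of GL_k in GL_a *)

Section GLExtension.
Variables (F : finFieldType) (k a : nat).
Hypothesis le_ka : (k <= a)%N.

(** The block matrix diag(m, 1), written with partial identities to avoid a cast along
    [a = k + (a - k)]. *)
Definition ext_mx (m : 'M[F]_k) : 'M_a := pid_mx k *m m *m pid_mx k + copid_mx k.

Lemma pid_ext_mx m : (pid_mx k : 'M_(k, a)) *m ext_mx m = m *m pid_mx k.
Proof.
rewrite mulmxDr !mulmxA pid_mx_id // pid_mx_1 mul1mx mul_pid_mx_copid //.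
by rewrite addr0.
Qed.

Lemma ext_mx_pid m : ext_mx m *m (pid_mx k : 'M_(a, k)) = pid_mx k *m m.
Proof.
rewrite mulmxDl -!mulmxA pid_mx_id // pid_mx_1 mulmx1 mul_copid_mx_pid //.
by rewrite addr0.
Qed.

Lemma ext_mxM m m' : ext_mx m *m ext_mx m' = ext_mx (m *m m').
Proof.
rewrite {1}/ext_mx mulmxDl -!mulmxA pid_ext_mx /ext_mx mulmxDr !mulmxA.
by rewrite mul_copid_mx_pid // !mul0mx add0r copid_mx_id.
Qed.

Lemma ext_mx1 : ext_mx 1%:M = 1%:M.
Proof. by rewrite /ext_mx mulmx1 pid_mx_id // addrC subrK. Qed.

Lemma ext_mx_unit (m : GL F k) : ext_mx m \in unitmx.
Proof.
have: ext_mx m *m ext_mx (invmx m) = 1%:M.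
  by rewrite ext_mxM mulmxV ?GLmxP ?ext_mx1.
by case/mulmx1_unit.
Qed.

End GLExtension.

(** * Elements of Xi as homomorphisms *)

Section XiValues.
Variables (C : numClosedFieldType) (F : finFieldType) (n k : nat).
Variable nu : irrep C [set: GL F k].
Local Notation d := (irrep_deg nu).
Local Notation Xn := (Xi n nu).

(** Vectors of Xi are coordinates in a basis of the Hom space; this recovers the homomorphism
    itself. *)
Definition xi_val (w : 'rV_(\rank (Defs.hom_mx nu (omegaR C F n k)))) :
  'M[C]_(d, #|{: 'M[F]_(n, k)}|) := vec_mx (val_submod w).

Lemma xi_valJ w g : xi_val (w *m Xn g) = xi_val w *m omegaL C F n k g.
Proof.
rewrite /xi_val val_submodJ ?inE //= -[val_submod w]vec_mxK mul_vec_lin.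
by rewrite !mxvecK.
Qed.

Lemma xi_val_eq0 w : (xi_val w == 0) = (w == 0).
Proof. by rewrite /xi_val vec_mx_eq0 val_submod_eq0. Qed.

Lemma xi_valB w w' : xi_val (w - w') = xi_val w - xi_val w'.
Proof. by rewrite /xi_val !linearB. Qed.

Lemma xi_valZ c w : xi_val (c *: w) = c *: xi_val w.
Proof. by rewrite /xi_val !linearZ. Qed.

Lemma xi_val_sum (I : finType) (P : pred I) w :
  xi_val (\sum_(i | P i) w i) = \sum_(i | P i) xi_val (w i).
Proof. by rewrite /xi_val !linear_sum. Qed.

Lemma xi_val_hom w h : nu h *m xi_val w = xi_val w *m omegaR C F n k h.
Proof.
have /Defs.hom_mxP: (mxvec (xi_val w) <= Defs.hom_mx nu (omegaR C F n k))%MS.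
  by rewrite vec_mxK val_submodP.
by apply; rewrite inE.
Qed.

Lemma xi_val_onto A :
  (forall h, nu h *m A = A *m omegaR C F n k h) -> exists w, xi_val w = A.
Proof.
move=> hA; exists (in_submod _ (mxvec A)).
by rewrite /xi_val in_submodK ?mxvecK //; apply/Defs.hom_mxP.
Qed.

(** Evaluation at a fixed vector of [nu] is a GL_n-map from Xi to omega; some basis vector makes its
    composite with [A] nonzero. *)
Lemma Xi_appears_omega (pi : irrep C [set: GL F n]) :
  appears_in pi Xn -> appears_in pi (omegaL C F n k).
Proof.
case/appears_inP=> [A nzA hA]; apply/appears_inP.
have [j nzj] : exists j, row j A != 0.
  apply/existsP; apply: contraNT nzA; rewrite negb_exists => /forallP zA.
  apply/eqP/row_matrixP=> j; rewrite row0; apply/eqP.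
  by have := zA j; rewrite negbK.
have [i nzi] : exists i, row i (xi_val (row j A)) != 0.
  apply/existsP; move: nzj; rewrite -xi_val_eq0; apply: contraNT.
  rewrite negb_exists => /forallP zA; apply/eqP/row_matrixP=> i; rewrite row0.
  by apply/eqP; have := zA i; rewrite negbK.
exists (\matrix_l row i (xi_val (row l A))).
  by apply: contraNneq nzi => /(congr1 (row j)); rewrite rowK row0 => ->.
move=> g Gg; apply/row_matrixP=> l; rewrite [LHS]row_mul [RHS]row_mul rowK.
rewrite -[RHS]row_mul -xi_valJ -[X in xi_val X]row_mul -hA //.
rewrite [X in xi_val X]row_mul [X in xi_val X]mulmx_sum_row xi_val_sum linear_sum.
rewrite [LHS]mulmx_sum_row; apply: eq_bigr => l' _.
by rewrite xi_valZ rowK linearZ.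
Qed.

End XiValues.

(** * Characters of U in the oscillator representation *)

Section UnipotentWeights.
Variables (C : numClosedFieldType) (F : finFieldType) (chi0 : F -> C).
Hypothesis chi0P : nontrivial_additive_character chi0.
Variables (a b : nat).
Local Notation n := (a + b)%N.
Variable u : 'M[F]_(a, b) -> GL F n.
Hypothesis uE : forall T, GLmx (u T) = block_mx 1%:M T 0 1%:M.

Local Notation weight T :=
  (@weight_vector _ _ [set: GL F n] _ u
     (fun T' => chi0 (\tr ((T : 'M[F]_(a, b))^T *m T'))) _).

Lemma u_mul_col m T (X1 : 'M_(a, m)) X2 :
  GLmx (u T) *m col_mx X1 X2 = col_mx (X1 + T *m X2) X2.
Proof. by rewrite uE mul_block_col !mul1mx mul0mx add0r. Qed.

Lemma weight_omegaE m T (v : 'rV_#|{: 'M[F]_(n, m)}|) T' X1 X2 :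
  weight T (omegaL C F n m) v ->
  v 0 (enum_rank (col_mx (X1 + T' *m X2) X2))
    = chi0 (\tr (T^T *m T')) * v 0 (enum_rank (col_mx X1 X2)).
Proof. by move/(_ T') => wv; rewrite -u_mul_col -mul_omegaLE wv mxE. Qed.

(* T' *m X2 = 0 makes u T' fix the point, so chi0 (\tr (T^T *m T')) = 1. *)
Lemma weight_support m T (v : 'rV_#|{: 'M[F]_(n, m)}|) X1 X2 :
  weight T (omegaL C F n m) v -> v 0 (enum_rank (col_mx X1 X2)) != 0 ->
  kermx X2 *m T^T = 0.
Proof.
move=> wv nzv; apply: (add_char_tr_nondegenerate chi0P) => S.
rewrite -mulmxA mxtrace_mulC -mulmxA; apply: (mulIf nzv); rewrite mul1r.
rewrite -weight_omegaE // -mulmxA mulmx_ker mulmx0 addr0 //.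
Qed.

(** At a point of the support, the left kernel of the bottom block lies in that of [T^T], so [T] has
    at most the rank of this block, which has [m] columns. *)
Lemma weight_rank m T (v : 'rV_#|{: 'M[F]_(n, m)}|) :
  weight T (omegaL C F n m) v -> v != 0 -> (\rank T <= m)%N.
Proof.
move=> wv nzv.
have [X nzX] : exists X, v 0 (enum_rank X) != 0.
  apply/existsP; apply: contraNT nzv; rewrite negb_exists => /forallP zv.
  apply/eqP/matrix_rankP => i X; rewrite mxE ord1; apply/eqP.
  by have := zv X; rewrite negbK.
rewrite -[X]vsubmxK in nzX; have /sub_kermxP/mxrankS := weight_support wv nzX.
rewrite !mxrank_ker mxrank_tr => le_ker.
apply: leq_trans (rank_leq_col (dsubmx X)).
by have := leq_sub2l b le_ker; rewrite !subKn ?rank_leq_row ?rank_leq_col.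
Qed.

(** The Levi subgroup moves characters of U by multiplying [T] on both sides, and Gaussian
    elimination brings [T] to [pid_mx k]. *)
Lemma weight_conj d (rho : mx_representation C [set: GL F n] d) k
    (T : 'M_(a, b)) v :
  \rank T = k -> weight T rho v -> v != 0 ->
  exists2 w, w != 0 & weight (pid_mx k) rho w.
Proof.
move=> rT wv nzv; pose L := (col_ebase T)^T; pose R := (row_ebase T)^T.
have uL : L \in unitmx by rewrite unitmx_tr col_ebase_unit.
have uR : R \in unitmx by rewrite unitmx_tr row_ebase_unit.
have ug : block_mx (invmx L) 0 0 R \in unitmx.
  by rewrite unitmxE det_ublock unitrM -!unitmxE unitmx_inv uL uR.
pose g := MkGL ug.
exists (v *m rho g).
  by rewrite mulmx_free_eq0 // row_free_unit repr_mx_unit ?inE.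
move=> T'; rewrite -mulmxA -repr_mxM ?inE //.
have -> : (g * u T' = u (invmx L *m T' *m invmx R) * g)%g.
  apply: val_inj; rewrite /= !uE /= !mulmx_block !mul0mx !mulmx0 !mulmx1 !mul1mx.
  by rewrite !addr0 !add0r mulmxKV.
rewrite repr_mxM ?inE // mulmxA wv -scalemxAl; congr (chi0 _ *: _).
rewrite -{1}(mulmx_ebase T) rT !trmx_mul tr_pid_mx -/L -/R.
rewrite !mulmxA mxtrace_mulC !mulmxA mulVmx // mul1mx.
by rewrite -(mulmxA _ L) mulmxV // mulmx1.
Qed.

(** * The weight space of maximal rank and its two GL_k actions *)

Section Orbit.
Variable k : nat.
Hypotheses (le_ka : (k <= a)%N) (le_kb : (k <= b)%N).
Local Notation T0 := (pid_mx k : 'M[F]_(a, b)).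

(** Representatives of the U-orbits that carry [T0]-weight vectors. *)
Definition base_pt (h : GL F k) : 'M[F]_(n, k) := col_mx 0 (pid_mx k *m (h : 'M_k)).

(* The T0-weight vectors of omega supported on a single U-orbit. *)
Definition orbit_vec (h : GL F k) : 'rV[C]_#|{: 'M[F]_(n, k)}| :=
  \row_j ((dsubmx (enum_val j) == pid_mx k *m (h : 'M_k))%:R
            * chi0 (\tr (pid_mx k *m usubmx (enum_val j) *m invmx h))).

Lemma orbit_vecE h X : orbit_vec h 0 (enum_rank X) =
  (dsubmx X == pid_mx k *m (h : 'M_k))%:R
    * chi0 (\tr (pid_mx k *m usubmx X *m invmx h)).
Proof. by rewrite mxE enum_rankK. Qed.

Lemma pid_mx_inj m :
  injective (mulmx (pid_mx k : 'M[F]_(b, k)) : 'M_(k, m) -> 'M_(b, m)).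
Proof.
move=> M N eqMN; rewrite -[M]mul1mx -[N]mul1mx -(pid_mx_1 _ k).
by rewrite -(@pid_mx_id _ k b k) // -!mulmxA eqMN.
Qed.

Lemma orbit_vec_base h h' : orbit_vec h 0 (enum_rank (base_pt h')) = (h == h')%:R.
Proof.
have [chi00 _ _] := chi0P.
rewrite orbit_vecE col_mxKd col_mxKu mulmx0 mul0mx linear0 chi00 mulr1.
by rewrite (inj_eq (@pid_mx_inj _)) eq_sym.
Qed.

Lemma orbit_vec_weight h : weight T0 (omegaL C F n k) (orbit_vec h).
Proof.
have [_ chi0D _] := chi0P.
move=> T; apply: matrix_rankP => i X; rewrite ord1 mul_omegaLE [RHS]mxE.
rewrite -[X]vsubmxK; move: (usubmx X) (dsubmx X) => X1 X2.
rewrite u_mul_col !orbit_vecE !col_mxKu !col_mxKd.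
case: eqP => [->|_]; last by rewrite !mul0r mulr0.
rewrite !mul1r mulmxDr mulmxDl linearD chi0D /= mulrC; congr (chi0 _ * _).
rewrite !mulmxA mulmxK ?GLmxP // mxtrace_mulC !mulmxA pid_mx_id // tr_pid_mx //.
Qed.

Lemma orbit_vecR h h' : orbit_vec h *m omegaR C F n k h' = orbit_vec (h * h')%g.
Proof.
apply: matrix_rankP => i X; rewrite ord1 mul_omegaRE !orbit_vecE.
have h'U := GLmxP h'; rewrite invmx_GLM GLmxM.
rewrite -{1 2}[X]vsubmxK mul_col_mx col_mxKd col_mxKu !mulmxA.
congr ((nat_of_bool _)%:R * _).
by apply/eqP/eqP=> [<-|->]; rewrite ?mulmxKV ?mulmxK.
Qed.

Fact levi_unit (m : GL F k) : block_mx (ext_mx a m) 0 0 (ext_mx b m) \in unitmx.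
Proof. by rewrite unitmxE det_ublock unitrM -!unitmxE !ext_mx_unit. Qed.

(** A copy of GL_k in the Levi subgroup that fixes the character [T0]. *)
Definition levi (m : GL F k) : GL F n := MkGL (levi_unit m).

Lemma orbit_vecL h m : orbit_vec h *m omegaL C F n k (levi m) = orbit_vec (m^-1 * h)%g.
Proof.
have mU := GLmxP m.
apply: matrix_rankP => i X; rewrite ord1 mul_omegaLE !orbit_vecE.
rewrite invmx_GLM !GLmxM !GLmxV invmxK.
rewrite -{1 2}[X]vsubmxK mul_block_col !mul0mx addr0 add0r col_mxKd col_mxKu.
rewrite !mulmxA pid_ext_mx // -!(mulmxA (m : 'M_k)) mxtrace_mulC.
congr ((nat_of_bool _)%:R * _); apply/eqP/eqP=> [eqX|->].
  have := congr1 (mulmx (ext_mx b (invmx m))) eqX.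
  by rewrite !mulmxA ext_mxM // mulVmx // ext_mx1 // mul1mx ext_mx_pid.
by rewrite !mulmxA ext_mx_pid // mulmxK.
Qed.

(** The support condition puts the bottom block in the form [pid_mx k *m H] with [H] invertible, so
    every point of the support is a U-translate of some [base_pt]. *)
Lemma weight_eq0 (v : 'rV_#|{: 'M[F]_(n, k)}|) :
  weight T0 (omegaL C F n k) v ->
  (forall h, v 0 (enum_rank (base_pt h)) = 0) -> v = 0.
Proof.
move=> wv zv; apply: matrix_rankP => i X; rewrite ord1 mxE.
apply: contraTeq isT => nzX; rewrite -[X]vsubmxK in nzX.
move: (usubmx X) (dsubmx X) nzX => X1 X2 nzX; have kerX := weight_support wv nzX.
have rX : \rank X2 = k.
  apply/eqP; rewrite eqn_leq rank_leq_col /=.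
  have /sub_kermxP/mxrankS := kerX; rewrite !mxrank_ker tr_pid_mx rank_pid_mx //.
  by move/(leq_sub2l b); rewrite !subKn ?rank_leq_row.
have eqK : (kermx X2 == kermx T0^T)%MS.
  have /sub_kermxP sK := kerX.
  by rewrite -(geq_leqif (mxrank_leqif_eq sK)) !mxrank_ker rX tr_pid_mx rank_pid_mx.
have defX2 : X2 = pid_mx k *m X2.
  have : copid_mx k *m X2 = 0.
    apply/sub_kermxP; rewrite (eqmxP eqK); apply/sub_kermxP.
    by rewrite tr_pid_mx mul_copid_mx_pid.
  by rewrite mulmxBl mul1mx => /eqP; rewrite subr_eq0 => /eqP.
have [H defX] : exists H : 'M_k, X2 = pid_mx k *m H.
  by exists (pid_mx k *m X2); rewrite {1}defX2 mulmxA pid_mx_id.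
have uH : H \in unitmx.
  rewrite -row_full_unit /row_full eqn_leq rank_leq_col -{1}rX defX.
  exact: mxrankM_maxr.
(* This exhibits [X1] as [T' *m X2], so the point is the translate of [base_pt] at [H] by [u T']. *)
have defX1 : X1 = X1 *m invmx H *m pid_mx k *m X2.
  rewrite defX !mulmxA -(mulmxA (X1 *m invmx H)) pid_mx_id // pid_mx_1.
  by rewrite mulmx1 mulmxKV.
case/eqP: nzX; rewrite -[X1]add0r defX1 (weight_omegaE _ _ _ wv) defX.
by have := zv (MkGL uH); rewrite /base_pt /= => ->; rewrite mulr0.
Qed.

(** * The [T0]-weight space of Xi *)

Section XiWeights.
Variable nu : irrep C [set: GL F k].
Local Notation d := (irrep_deg nu).
Local Notation Xn := (Xi n nu).

(** The column [c] is the value at the base point of 1; the factor [nu h^-1%g] is forced by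
    GL_k-equivariance. *)
Definition orbit_hom (c : 'cV[C]_d) : 'M[C]_(d, #|{: 'M[F]_(n, k)}|) :=
  \sum_h nu h^-1%g *m c *m orbit_vec h.

Lemma orbit_hom_base c h :
  col (enum_rank (base_pt h)) (orbit_hom c) = nu h^-1%g *m c.
Proof.
rewrite /orbit_hom linear_sum (bigD1 h) //= big1 ?addr0 => [|h' neh].
  apply/colP=> i; rewrite mxE mxE big_ord1 orbit_vec_base eqxx mulr1 //.
by apply/colP=> i; rewrite mxE mxE big_ord1 orbit_vec_base (negPf neh) mulr0 mxE.
Qed.

Lemma orbit_homR c h : nu h *m orbit_hom c = orbit_hom c *m omegaR C F n k h.
Proof.
rewrite mulmx_sumr mulmx_suml [RHS](reindex_inj (mulIg h^-1%g)).
apply: eq_bigr => h' _; rewrite -!mulmxA orbit_vecR mulgKV !mulmxA.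
by rewrite -repr_mxM ?inE // invMg invgK.
Qed.

Lemma orbit_homL c m :
  orbit_hom c *m omegaL C F n k (levi m) = orbit_hom (nu m^-1%g *m c).
Proof.
rewrite mulmx_suml (reindex_inj (mulgI m)).
apply: eq_bigr => h _; rewrite -!mulmxA orbit_vecL mulKg !mulmxA.
by rewrite -repr_mxM ?inE // invMg.
Qed.

Lemma weight_homE A : (forall h, nu h *m A = A *m omegaR C F n k h) ->
  (forall i, weight T0 (omegaL C F n k) (row i A)) ->
  A = orbit_hom (col (enum_rank (base_pt 1%g)) A).
Proof.
move=> hA wA; apply/eqP; rewrite -subr_eq0; apply/eqP/row_matrixP=> i.
rewrite row0; apply: weight_eq0 => [T|h].
  rewrite linearB /= mulmxBl wA scalerBr; congr (_ - _).
  rewrite linear_sum /= mulmx_suml scaler_sumr; apply: eq_bigr => h _.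
  by rewrite row_mul -mulmxA orbit_vec_weight -scalemxAr.
rewrite mxE mxE [X in _ + X]mxE; apply/eqP; rewrite subr_eq0; apply/eqP.
have := orbit_hom_base (col (enum_rank (base_pt 1%g)) A) h.
move/colP/(_ i); rewrite mxE => ->.
rewrite colE mulmxA -colE hA mxE mul_omegaRE GLmxV invmxK.
by congr (A _ (enum_rank _)); rewrite /base_pt mul_col_mx mul0mx GLmx1 mulmx1.
Qed.

Lemma Xi_weightP w : weight T0 Xn w ->
  exists2 c, xi_val w = orbit_hom c & (w != 0 -> c != 0).
Proof.
move=> ww.
have wA i : weight T0 (omegaL C F n k) (row i (xi_val w)).
  move=> T; rewrite -row_mul -xi_valJ ww.
  by rewrite xi_valZ linearZ.
have defA := weight_homE (xi_val_hom w) wA.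
exists (col (enum_rank (base_pt 1%g)) (xi_val w)) => //.
apply: contraNneq => c0; rewrite -xi_val_eq0 defA c0 /orbit_hom big1 // => h _.
by rewrite mulmx0 mul0mx.
Qed.

(** Through [c], the Levi copy of GL_k acts on the weight space as the dual of [nu], and by
    irreducibility any nonzero column generates all columns. *)
Lemma Xi_weight_cyclic w w' : weight T0 Xn w -> w != 0 -> weight T0 Xn w' ->
  (w' <= cyclic_mx Xn w)%MS.
Proof.
move=> /Xi_weightP[c defw /[apply] nzc] /Xi_weightP[c' defw' _].
have [i nzi] : exists i, c i 0 != 0.
  apply/existsP; apply: contraNT nzc; rewrite negb_exists => /forallP zc.
  by apply/eqP/colP=> i; rewrite mxE; apply/eqP; have := zc i; rewrite negbK.
pose D := (c i 0)^-1 *: (c' *m delta_mx 0 i : 'M_d).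
have Dc : D *m c = c'.
  rewrite -scalemxAl -mulmxA -rowE [row i c](_ : _ = (c i 0)%:M).
    by rewrite mul_mx_scalar scalerA mulVf ?scale1r.
  by apply/matrixP=> x y; rewrite !ord1 !mxE.
(* Burnside: the matrices [nu x] span the full matrix algebra. *)
have [al defD] : exists al, D = \sum_(x in [set: GL F k]) al x *: nu x.
  by have /mx_abs_irrP[_ [al /(_ D) defD]] := irrep_abs_irr nu; exists (al^~ D).
have -> : w' = \sum_(x in [set: GL F k]) al x *: (w *m Xn (levi x^-1%g)).
  apply/eqP; rewrite -subr_eq0 -xi_val_eq0 xi_valB subr_eq0; apply/eqP.
  rewrite xi_val_sum defw' -Dc defD.
  transitivity (\sum_(x in [set: GL F k]) al x *: orbit_hom (nu x *m c)).
    rewrite /orbit_hom; under eq_bigr do rewrite mulmx_suml mulmx_sumr mulmx_suml.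
    rewrite exchange_big; apply: eq_bigr => x _; rewrite scaler_sumr.
    by apply: eq_bigr => h _; rewrite -!scalemxAl -scalemxAr -scalemxAl.
  by apply: eq_bigr => x _; rewrite xi_valZ xi_valJ defw orbit_homL invgK.
apply: summx_sub => x _; apply: scalemx_sub.
by rewrite mxmodule_trans ?cyclic_mx_module ?cyclic_mx_id ?inE.
Qed.

Lemma Xi_weight_exists : exists2 w, w != 0 & weight T0 Xn w.
Proof.
have [d_gt0 _] := (mx_irrP nu).1 (irrep_irr nu).
(* Any nonzero column would do; [const_mx 1] is nonzero because [nu] has positive degree. *)
have [w defw] := xi_val_onto (orbit_homR (const_mx 1)).
exists w.
  rewrite -xi_val_eq0 defw; apply/eqP=> z.
  have := orbit_hom_base (const_mx 1) 1%g; rewrite z invg1 repr_mx1 mul1mx.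
  move/colP/(_ (Ordinal d_gt0)); rewrite !mxE => /esym/eqP.
  by rewrite oner_eq0.
move=> T; apply/eqP; rewrite -subr_eq0 -xi_val_eq0 xi_valB subr_eq0.
rewrite xi_valJ xi_valZ defw.
rewrite mulmx_suml scaler_sumr; apply/eqP/eq_bigr => h _.
by rewrite -!mulmxA orbit_vec_weight -!scalemxAr.
Qed.

End XiWeights.
End Orbit.

(** Suppose there is no such weight vector. The projection [K] onto a copy of [pi] acts as the same
    combination [al] of GL_k on [A] and on [orbit_vec 1]. It kills the latter, which forces [al] to
    vanish, yet it fixes [A]. *)
Lemma weight_of_new k' (pi : irrep C [set: GL F n]) :
  (k'.+1 <= a)%N -> (k'.+1 <= b)%N ->
  appears_in pi (omegaL C F n k'.+1) -> ~ appears_in pi (omegaL C F n k') ->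
  exists2 v, v != 0 & weight (pid_mx k'.+1) pi v.
Proof.
move=> le_ka le_kb /appears_inP[A nzA hA] not_low; apply: contrapT => no_wt.
have wt0 v : weight (pid_mx k'.+1) pi v -> v = 0.
  by move=> wv; apply/eqP; apply: contrapT => /negP nz; apply: no_wt; exists v.
have [B hB AB] := intertwines_retraction hA (intertwines_row_free hA nzA).
pose K := B *m A; have hK := intertwinesM hB hA.
pose phi (M : 'M[F]_(n, k'.+1 + k'.+1)) :=
  K (enum_rank (lsubmx M)) (enum_rank (rsubmx M)).
have defK : kernel_mx phi = K.
  apply: matrix_rankP => i X; rewrite -(enum_valK i) fun_mxE.
  by rewrite /phi row_mxKl row_mxKr.
have inv_phi g M : g \in unitmx -> phi (g *m M) = phi M.
  move=> gU; pose h := MkGL gU.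
  rewrite -[M]hsubmxK mul_mx_row /phi !row_mxKl !row_mxKr.
  move: (lsubmx M) (rsubmx M) => X Y.
  have := hK h (in_setT h); move/matrixP/(_ (enum_rank (g *m X)) (enum_rank Y)).
  rewrite mul_omegaLE -/K -defK mul_fun_mxE (bigD1 X) //= omegaLE eqxx mul1r big1.
    rewrite addr0 -[phi _](fun_mxE (fun X Y => phi (row_mx X Y))).
    by rewrite -/(kernel_mx phi) defK.
  move=> Z neZ; rewrite omegaLE; case: eqP => [eqZ|_]; last by rewrite mul0r.
  by case/eqP: neZ; rewrite -[Z](mulKmx gU) eqZ mulKmx.
have [al hal] := invariant_acts_by_GL inv_phi.
(* Otherwise [pi] would occur in the smaller oscillator representation. *)
have lowA : low_killed A.
  have kill D : intertwines (omegaL C F n k'.+1) (omegaL C F n k') D -> A *m D = 0.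
    move=> hD; apply/eqP; apply: contrapT => /negP nz; apply: not_low.
    by apply/appears_inP; exists (A *m D); last exact: intertwinesM hA hD.
  by split=> P; apply: kill; [apply: push_intertwines | apply: push_tr_intertwines].
(* A weight of rank [k'.+1] cannot occur in the smaller oscillator representation. *)
have low1 : low_killed (orbit_vec (1%g : GL F k'.+1)).
  have kill D : intertwines (omegaL C F n k'.+1) (omegaL C F n k') D ->
      orbit_vec (1%g : GL F k'.+1) *m D = 0.
    move=> hD; apply/eqP; apply: contraT => nz.
    have := weight_rank (weight_vector_intertwines (fun=> in_setT _) hD (orbit_vec_weight _)) nz.
    by rewrite rank_pid_mx // ltnn; apply.
  by split=> P; apply: kill; [apply: push_intertwines | apply: push_tr_intertwines].
(* Evaluating at [base_pt h] isolates the coefficient [al h], as the translates of [orbit_vec 1] are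
   dual to the base points. *)
have al0 h : al h = 0.
  have := hal _ _ low1; rewrite defK mulmxA (wt0 (_ *m B)); last first.
    exact: (weight_vector_intertwines (fun=> in_setT _) hB (orbit_vec_weight _)).
  rewrite mul0mx => /matrixP/(_ 0 (enum_rank (base_pt h))).
  rewrite mxE summxE (bigD1 h) //= mxE orbit_vecR mul1g orbit_vec_base // eqxx mulr1.
  rewrite big1 ?addr0 // => h' neh.
  by rewrite mxE orbit_vecR mul1g orbit_vec_base // (negPf neh) mulr0.
case/eqP: nzA; rewrite -[A]mul1mx -AB -mulmxA -/K -defK hal // big1 // => h _.
by rewrite al0 scale0r.
Qed.

End UnipotentWeights.

Lemma omegaL0 (C : numClosedFieldType) (F : finFieldType) n g :
  omegaL C F n 0 g = 1%:M.
Proof.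
rewrite -[LHS]mul1mx; apply: matrix_rankP => i X; rewrite mul_omegaLE.
by rewrite [GLmx g *m X]thinmx0 [X]thinmx0.
Qed.

(* Replaces n by a sum, so that no cast remains in the elements of U. *)
Lemma U_elt_coordinates (F : finFieldType)
    (P : forall a b n, ('M[F]_(a, b) -> GL F n) -> Prop) n :
  (forall a b (u : 'M_(a, b) -> GL F (a + b)),
     (forall T, GLmx (u T) = block_mx 1%:M T 0 1%:M) -> P a b (a + b)%N u) ->
  P n./2 (uphalf n) n (@U_elt F n).
Proof.
move=> HP; have castP a b m (e : (a + b)%N = m) (u : 'M_(a, b) -> GL F m) :
    (forall T, GLmx (u T) = castmx (e, e) (block_mx 1%:M T 0 1%:M)) -> P a b m u.
  by case: m / e u => u uE; apply: HP => T; rewrite uE castmx_id.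
exact: (castP _ _ _ (U_size n)).
Qed.

(** * U-rank and the new spectrum *)

Section UCharacters.
Variables (C : numClosedFieldType) (F : finFieldType) (chi0 : F -> C).
Hypothesis chi0P : nontrivial_additive_character chi0.
Variable n : nat.
Implicit Type pi : irrep C [set: GL F n].
Local Notation T0 k := (pid_mx k : 'M[F]_(n./2, uphalf n)).

Lemma U_char_rank_le m pi T :
  appears_in pi (omegaL C F n m) -> U_char_appears chi0 pi T -> (\rank T <= m)%N.
Proof.
move=> /appears_inP[A nzA hA] [v nzv wv].
have nzvA : v *m A != 0 by rewrite mulmx_free_eq0 // (intertwines_row_free hA).
have wvA := weight_vector_intertwines (fun T => in_setT (U_elt T)) hA wv.
move: (v *m A) wvA nzvA; clear v nzv wv A nzA hA pi; move: T; rewrite /U_char.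
apply: (U_elt_coordinates (P := fun a b n u => forall T w,
  weight_vector u (fun T' => chi0 (\tr (T^T *m T'))) (omegaL C F n m) w ->
  w != 0 -> (\rank T <= m)%N)) => a b u uE T w.
exact: weight_rank.
Qed.

Lemma U_rank_le m pi : appears_in pi (omegaL C F n m) -> (U_rank chi0 pi <= m)%N.
Proof.
by move=> app; apply/bigmax_leqP => T /asboolP; apply: U_char_rank_le.
Qed.

Lemma U_char_appears_pid k pi (T : 'M_(n./2, uphalf n)) :
  \rank T = k -> U_char_appears chi0 pi T -> U_char_appears chi0 pi (T0 k).
Proof.
move=> rT [v nzv wv]; move: pi T v rT wv nzv; rewrite /U_char_appears /U_char.
apply: (U_elt_coordinates (P := fun a b n u => forall (pi : irrep C [set: GL F n])
    (T : 'M_(a, b)) (v : 'rV_(irrep_deg pi)), \rank T = k ->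
  weight_vector u (fun T' => chi0 (\tr (T^T *m T'))) pi v -> v != 0 ->
  exists2 w : 'rV_(irrep_deg pi), w != 0 &
    weight_vector u (fun T' => chi0 (\tr ((pid_mx k : 'M_(a, b))^T *m T'))) pi w))
  => a b u uE pi T v.
exact: weight_conj.
Qed.

(** There is only one n by 0 matrix, so omega is the trivial representation. This settles [k = 0],
    where the new spectrum is defined separately. *)
Lemma omega0_irrep pi : appears_in pi (omegaL C F n 0) ->
  is_trivial_irrep pi /\ U_char_appears chi0 pi (T0 0).
Proof.
move=> /appears_inP[A nzA hA]; have freeA := intertwines_row_free hA nzA.
have pi1 g : pi g = 1%:M.
  apply: (row_free_inj freeA); rewrite hA ?inE // omegaL0.
  by rewrite mulmx1 mul1mx.
have [deg_gt0 _] := (mx_irrP pi).1 (irrep_irr pi).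
split.
  split=> // ; apply/eqP; rewrite eqn_leq deg_gt0 andbT -(eqnP freeA).
  by apply: leq_trans (rank_leq_col A) _; rewrite card_mx muln0 expn0.
exists (const_mx 1).
  apply/eqP=> /rowP/(_ (Ordinal deg_gt0)); rewrite !mxE => /eqP.
  by rewrite oner_eq0.
have [chi00 _ _] := chi0P.
by move=> T; rewrite pi1 mulmx1 /U_char pid_mx_0 trmx0 mul0mx mxtrace0 chi00 scale1r.
Qed.

Section Rank.
Variable k : nat.
Hypothesis k_lt : (k < n./2)%N.

Let le_ka : (k <= n./2)%N := ltnW k_lt.
Let le_kb : (k <= uphalf n)%N.
Proof. by rewrite uphalf_half (leq_trans le_ka) ?leq_addl. Qed.

Lemma rank_T0 : \rank (T0 k) = k.
Proof. exact: rank_pid_mx. Qed.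

Lemma U_rankP pi : appears_in pi (omegaL C F n k) ->
  U_rank chi0 pi = k <-> U_char_appears chi0 pi (T0 k).
Proof.
move=> app; split=> [rk|appT]; last first.
  apply/eqP; rewrite eqn_leq U_rank_le //= -[X in (X <= _)%N]rank_T0.
  by apply: (bigmax_sup (T0 k)); first exact/asboolP.
(* An empty maximum is also 0, so for [k = 0] the rank alone does not provide a character. *)
have [k0|k_gt0] := posnP k.
  by move: app; rewrite k0 => /omega0_irrep[].
apply: contrapT => noT; have : (U_rank chi0 pi <= k.-1)%N.
  apply/bigmax_leqP => T /asboolP appT; rewrite -ltnS prednK //.
  rewrite ltn_neqAle (U_char_rank_le app appT) andbT; apply/eqP=> rT.
  by case: noT; apply: U_char_appears_pid appT.
by rewrite rk -ltnS prednK // ltnn.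
Qed.

(** A character of rank [k] excludes [pi] from the smaller oscillator representation by the rank
    bound; conversely [weight_of_new] produces one. *)
Lemma new_spectrumP pi : appears_in pi (omegaL C F n k) ->
  new_spectrum k pi <-> U_rank chi0 pi = k.
Proof.
move=> app; apply: iff_trans (iff_sym (U_rankP app)).
move: k_lt (le_kb) app rank_T0; case: k => [|k'] lt_ka le_kb' app rT0 /=.
  by have [] := omega0_irrep app.
split=> [[_ not_low]|appT].
  move: pi (ltnW lt_ka) le_kb' app not_low; rewrite /U_char_appears /U_char.
  apply: (U_elt_coordinates (P := fun a b n u => forall pi : irrep C [set: GL F n],
    (k' < a)%N -> (k' < b)%N -> appears_in pi (omegaL C F n k'.+1) ->
    ~ appears_in pi (omegaL C F n k') ->
    exists2 w : 'rV_(irrep_deg pi), w != 0 & weight_vector u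
      (fun T' => chi0 (\tr ((pid_mx k'.+1 : 'M_(a, b))^T *m T'))) pi w))
    => a b u uE pi.
  exact: weight_of_new.
split=> // low; have := U_char_rank_le low appT.
by rewrite rT0 ltnn.
Qed.

Lemma Xi_T0_component (nu : irrep C [set: GL F k]) :
  exists eta_nu : irrep C [set: GL F n],
    [/\ appears_in eta_nu (Xi n nu), U_char_appears chi0 eta_nu (T0 k),
        forall pi, appears_in pi (Xi n nu) -> U_char_appears chi0 pi (T0 k) ->
          iso_irrep pi eta_nu
      & multiplicity eta_nu (Xi n nu) = 1%N].
Proof.
move: (le_ka) (le_kb) nu; rewrite /U_char_appears /U_char.
apply: (U_elt_coordinates (P := fun a b n u => (k <= a)%N -> (k <= b)%N ->
  forall nu : irrep C [set: GL F k], exists eta_nu : irrep C [set: GL F n],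
    [/\ appears_in eta_nu (Xi n nu),
        exists2 w : 'rV_(irrep_deg eta_nu), w != 0 & weight_vector u
          (fun T' => chi0 (\tr ((pid_mx k : 'M_(a, b))^T *m T'))) eta_nu w,
        forall pi : irrep C [set: GL F n], appears_in pi (Xi n nu) ->
          (exists2 w : 'rV_(irrep_deg pi), w != 0 & weight_vector u
            (fun T' => chi0 (\tr ((pid_mx k : 'M_(a, b))^T *m T'))) pi w) ->
          iso_irrep pi eta_nu
      & multiplicity eta_nu (Xi n nu) = 1%N])) => a b u uE le_a le_b nu.
have [w0 nzw0 ww0] := Xi_weight_exists chi0P uE le_b nu.
apply: (cyclic_weight_irrep (fun=> in_setT _) nzw0 ww0) => w w' ww nzw ww'.
exact: (Xi_weight_cyclic chi0P uE le_a le_b ww nzw ww').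
Qed.

End Rank.
End UCharacters.

Theorem theorem0p4p6 (C : numClosedFieldType) (F : finFieldType)
    (chi0 : F -> C) (chi0P : nontrivial_additive_character chi0)
    (n k : nat) (n_ge1 : (1 <= n)%N) (k_lt : (k < n./2)%N) :
  (isotypic_sum (omegaL C F n k) (fun pi => new_spectrum k pi)
     :=: isotypic_sum (omegaL C F n k) (fun pi => U_rank chi0 pi = k))%MS
  /\
  forall nu : irrep C [set: GL F k],
    eta_domain n nu /\
    exists eta_nu : irrep C [set: GL F n],
      [/\ eta nu eta_nu /\
            (forall pi : irrep C [set: GL F n],
               eta nu pi -> iso_irrep pi eta_nu),
          U_rank chi0 eta_nu = k /\ appears_in eta_nu (Xi n nu),
          forall pi : irrep C [set: GL F n],
            U_rank chi0 pi = k -> appears_in pi (Xi n nu) ->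
            iso_irrep pi eta_nu,
          multiplicity eta_nu (Xi n nu) = 1%N
        & forall pi : irrep C [set: GL F n],
            appears_in pi (Xi n nu) -> ~ iso_irrep pi eta_nu ->
            (U_rank chi0 pi < k)%N].
Proof.
split=> [|nu].
  (* Both sums run over the same isotypic components, since the two conditions agree on every
     constituent of omega. *)
  rewrite /isotypic_sum (eq_bigl (fun W => `[< U_rank chi0 (irrep_of_socle W) = k >])) //.
  move=> W; apply: asbool_equiv_eq; apply: (new_spectrumP chi0P k_lt).
  by exists (socle_base W), (socle_module W); apply: mx_rsim_refl.
have [eta_nu [app_eta T0_eta uniq_eta mult_eta]] := Xi_T0_component chi0P k_lt nu.
have rankP pi : appears_in pi (Xi n nu) ->
    U_rank chi0 pi = k <-> U_char_appears chi0 pi (pid_mx k).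
  by move/Xi_appears_omega/(U_rankP chi0P k_lt).
have newP pi : appears_in pi (Xi n nu) -> new_spectrum k pi <-> U_rank chi0 pi = k.
  by move/Xi_appears_omega/(new_spectrumP chi0P k_lt).
have uniq_rank pi : U_rank chi0 pi = k -> appears_in pi (Xi n nu) ->
    iso_irrep pi eta_nu.
  by move=> rk app; apply: uniq_eta => //; apply/rankP.
have rank_eta : U_rank chi0 eta_nu = k by apply/rankP.
have eta_eta : eta nu eta_nu by split=> //; apply/newP.
split; first by exists eta_nu.
exists eta_nu; split=> //.
  by split=> // pi [new_pi app]; apply: uniq_rank => //; apply/newP.
move=> pi app not_iso.
(* The rank is at most [k], and equality would make [pi] isomorphic to [eta_nu]. *)
rewrite ltn_neqAle (U_rank_le chi0P) ?andbT; last exact: Xi_appears_omega app.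
by apply/eqP=> rk; apply: not_iso; apply: uniq_rank.
Qed.
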